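(* For every $L>0$, $u\in\mathcal C$, $(t,x)\in M$ and $i\in\{1,2,3\}$, $$R_i[\Phi_L(u)](t,x)=L\,R_i[u](Lt,Lx),$$ where $$R_i[u]:=\frac{\partial(\bar\rho\,\widetilde u_i)}{\partial t}+\frac{\partial}{\partial x_j}\bigl[\bar\rho\,\widetilde u_i\widetilde u_j+\bar p\,\delta_{ij}-\bar\tau_{ij}\bigr]+\frac{\partial\tau^{\mathrm{sgs}}_{ij}}{\partial x_j}.$$ Hence $R_i[\Phi_L(u)]=0$ if and only if $R_i[u]=0$.
   Context: The repeated index $j$ is summed over $1,2,3$. $M=I\times\Omega$ with $I\subset\mathbb R$ an open interval and $\Omega\subset\mathbb R^3$ open, with coordinates $(t,x_1,x_2,x_3)$, such that for every $L>0$ the dilation $\phi_L(t,x)=(Lt,Lx)$ maps $M$ onto $M$. $\mathcal C=C^\infty(M,V)$, $V\cong\mathbb R^{40}$, is the space of smooth field tuples $u=(\bar\rho,\widetilde u_i,\bar p,\bar E,\bar\tau_{ij},\bar q_i,\tau^{\mathrm{sgs}}_{ij},H^{\mathrm{sgs}}_i,\sigma^{\mathrm{sgs}}_{ij},\dot{Q\omega})$, $i,j=1,2,3$, with all components independent real-valued functions. The map $\Phi_L:\mathcal C\to\mathcal C$ is $(\Phi_Lu)(t,x)=(\phi_L^*u)(t,x)=u(Lt,Lx)$, applied to every component. *)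

(* Defs.v *)
From HB Require Import structures.
From mathcomp Require Import all_boot all_order all_algebra.
From mathcomp Require Import all_classical all_reals all_analysis.

Set Implicit Arguments.
Unset Strict Implicit.
Unset Printing Implicit Defensive.
Import Order.TTheory GRing.Theory Num.Theory.
Import numFieldNormedType.Exports.
Local Open Scope classical_set_scope.
Local Open Scope ring_scope.

Definition spacetime (R : realType) : normedModType R := (R * 'rV[R]_3)%type.

(* Coordinate directions of spacetime; the index j : 'I_3 stands for
   x_(j+1). *)
Definition dir_t (R : realType) : spacetime R := (1, 0).
Definition dir_x (R : realType) (j : 'I_3) : spacetime R := (0, delta_mx 0 j).

Definition dir (R : realType) (k : option 'I_3) : spacetime R :=
  if k is Some j then dir_x R j else dir_t R.

Definition partial_t (R : realType) (W : normedModType R)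
  (f : spacetime R -> W) : spacetime R -> W := 'D_(dir_t R) f.

Definition partial_x (R : realType) (W : normedModType R) (j : 'I_3)
  (f : spacetime R -> W) : spacetime R -> W := 'D_(dir_x R j) f.

Definition iter_partial (R : realType) (W : normedModType R)
    (s : seq (option 'I_3)) (f : spacetime R -> W) : spacetime R -> W :=
  foldr (fun k g => 'D_(dir R k) g) f s.

(* A function on the open set M is represented by a total function whose values
   off M are irrelevant: on an open M, the iterated partial derivatives at the
   points of M only depend on the restriction to M. *)
Definition smooth_on (R : realType) (W : normedModType R)
    (M : set (spacetime R)) (f : spacetime R -> W) : Prop :=
  forall (s : seq (option 'I_3)) (z : spacetime R), M z ->
    {for z, continuous (iter_partial s f)} /\
    forall k : option 'I_3, derivable (iter_partial s f) z (dir R k).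

(* V = R^40, in the order
   rho, u_i, p, E, tau_ij, q_i, tau^sgs_ij, H^sgs_i, sigma^sgs_ij, Q_omega
   (1 + 3 + 1 + 1 + 9 + 3 + 9 + 3 + 9 + 1); the matrices are not assumed to be
   symmetric. *)
Definition fieldV (R : realType) : normedModType R :=
  (R * 'rV[R]_3 * R * R * 'M[R]_3 * 'rV[R]_3 * 'M[R]_3 * 'rV[R]_3 * 'M[R]_3
   * R)%type.

Section components.
Context {R : realType}.
Implicit Type v : fieldV R.

Definition rho v : R :=
  let: (r, _, _, _, _, _, _, _, _, _) := v in r.
Definition vel v (i : 'I_3) : R :=
  let: (_, u, _, _, _, _, _, _, _, _) := v in u 0 i.
Definition pressure v : R :=
  let: (_, _, p, _, _, _, _, _, _, _) := v in p.
Definition energy v : R :=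
  let: (_, _, _, e, _, _, _, _, _, _) := v in e.
Definition tau v (i j : 'I_3) : R :=
  let: (_, _, _, _, t, _, _, _, _, _) := v in t i j.
Definition heat_flux v (i : 'I_3) : R :=
  let: (_, _, _, _, _, q, _, _, _, _) := v in q 0 i.
Definition tau_sgs v (i j : 'I_3) : R :=
  let: (_, _, _, _, _, _, t, _, _, _) := v in t i j.
Definition H_sgs v (i : 'I_3) : R :=
  let: (_, _, _, _, _, _, _, h, _, _) := v in h 0 i.
Definition sigma_sgs v (i j : 'I_3) : R :=
  let: (_, _, _, _, _, _, _, _, s, _) := v in s i j.
Definition heat_release v : R :=
  let: (_, _, _, _, _, _, _, _, _, q) := v in q.
End components.

Definition field_space (R : realType) (M : set (spacetime R)) :
  set (spacetime R -> fieldV R) := [set u | smooth_on M u].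

Definition dilation (R : realType) (L : R) (z : spacetime R) : spacetime R :=
  (L * z.1, L *: z.2).

Definition Phi (R : realType) (L : R) (u : spacetime R -> fieldV R) :
  spacetime R -> fieldV R := u \o dilation L.

Definition momentum (R : realType) (i : 'I_3) (u : spacetime R -> fieldV R) :
    spacetime R -> R := fun z =>
  partial_t (fun y => rho (u y) * vel (u y) i) z
  + \sum_(j < 3) partial_x j
      (fun y => rho (u y) * vel (u y) i * vel (u y) j
                + pressure (u y) * (i == j)%:R - tau (u y) i j) z
  + \sum_(j < 3) partial_x j (fun y => tau_sgs (u y) i j) z.

Lemma dilationE (R : realType) (L : R) (z : spacetime R) :
  dilation L z = L *: z.
Proof. by case: z. Qed.

Lemma is_derive_dilation (R : realType) (W : normedModType R) (L : R)
    (f : spacetime R -> W) (z v : spacetime R) :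
  0 < L -> derivable f (dilation L z) v ->
  is_derive z v (f \o dilation L) (L *: 'D_v f (dilation L z)).
Proof.
move=> L0 df.
suff cf : h^-1 *: (((f \o dilation L) \o shift z) (h *: v)
            - (f \o dilation L) z) @[h --> 0^']
          --> L *: 'D_v f (dilation L z).
  by apply: DeriveDef; [apply/cvg_ex; exists (L *: 'D_v f (dilation L z))
                       | exact: cvg_lim cf].
have cL : (L * h) @[h --> (0 : R)^'] --> (0 : R)^'.
  move=> A /= [e /= e0 eA].
  exists (e / L); first by rewrite /= divr_gt0.
  move=> h /= hL h0; apply: eA; last by rewrite mulf_neq0// gt_eqF.
  move: hL; rewrite /= !sub0r !normrN normrM gtr0_norm// ltr_pdivlMr//.
  by rewrite mulrC.
have cf := cvgZr (k := L) (cvg_comp _ _ cL df).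
apply: (cvg_trans _ (cf _)); apply: near_eq_cvg.
near=> h.
have h0 : h != 0 by near: h; exact: nbhs_dnbhs_neq.
rewrite /= !dilationE scalerA invfM mulrA mulfV ?gt_eqF// mul1r.
by rewrite (scalerDr L) scalerA.
Unshelve. all: by end_near. Qed.

Lemma iter_partial_dilation (R : realType) (W : normedModType R) (L : R)
    (M : set (spacetime R)) (f : spacetime R -> W) (s : seq (option 'I_3)) :
  0 < L -> open M -> (forall z, M z -> M (dilation L z)) -> smooth_on M f ->
  forall z, M z -> iter_partial s (f \o dilation L) z
                   = L ^+ size s *: iter_partial s f (dilation L z).
Proof.
move=> L0 oM LM fM; elim: s => [|k s IHs] z Mz /=; first by rewrite scale1r.
have [_ /(_ k) df] := fM s _ (LM _ Mz).
have D := is_derive_dilation L0 df.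
transitivity ('D_(dir R k) (L ^+ size s *: (iter_partial s f \o dilation L)) z).
  apply: near_eq_derive.
  by have := open_nbhs_nbhs (conj oM Mz); apply: filterS => y /IHs.
rewrite deriveZ; last by case: D.
by case: D => _ ->; rewrite scalerA exprSr.
Qed.

Lemma Phi_field_space (R : realType) (L : R) (M : set (spacetime R)) :
  0 < L -> open M -> dilation L @` M = M ->
  set_fun (field_space M) (field_space M) (Phi L).
Proof.
move=> L0 oM LM u uM s z Mz.
have {}LM y : M y -> M (dilation L y) by move=> My; rewrite -LM; exists y.
have E : \near z, L ^+ size s *: iter_partial s u (dilation L z)
                  = iter_partial s (Phi L u) z.
  have := open_nbhs_nbhs (conj oM Mz); apply: filterS => y My.
  by rewrite (iter_partial_dilation s L0 oM LM uM).
have [cu du] := uM s _ (LM _ Mz).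
split=> [|k].
  rewrite /prop_for /continuous_at -(nbhs_singleton E).
  apply: cvg_trans (near_eq_cvg E) _.
  apply: cvgZr; apply: continuous_comp => //.
  rewrite (_ : dilation L = fun y => L *: y); last exact/funext/dilationE.
  exact: scaler_continuous.
apply: (near_eq_derivable E).
by apply: (@derivableZ _ _ _ (iter_partial s u \o dilation L));
  case: (is_derive_dilation L0 (du k)).
Qed.

(* Main.v *)
Require Import Defs.
From mathcomp Require Import all_boot all_order all_algebra.
From mathcomp Require Import all_classical all_reals all_analysis.
Import Order.TTheory GRing.Theory Num.Theory.
Import numFieldNormedType.Exports.
Local Open Scope classical_set_scope.
Local Open Scope ring_scope.

(** Every term of the momentum residual is a first-order partial derivative of
    a function of the field values at a point.  Forming such a function
    pointwise commutes with the pullback along the dilation [z |-> L *: z], and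
    each derivative of a pulled-back function picks up exactly one factor [L]
    by the chain rule ([derive_dilation]).  So the residual is homogeneous of
    degree 1 ([momentum_Phi]).  As [L] is nonzero and the dilation maps the
    domain onto itself, the residual of the pulled-back field vanishes on the
    domain exactly when the original one does. *)

(** The dilation is invertible, so derivability transfers in both directions:
    the inverse dilation, by [L^-1], carries [f \o dilation L] back to [f]. *)
Lemma derivable_dilation (R : realType) (W : normedModType R) (L : R)
    (f : spacetime R -> W) (z v : spacetime R) : 0 < L ->
  derivable (f \o dilation L) z v <-> derivable f (dilation L z) v.
Proof.
move=> L0; split=> [df|df]; last by case: (is_derive_dilation L0 df).
have Ln0 : L != 0 by rewrite gt_eqF.
have LK y : dilation L (dilation L^-1 y) = y.
  by rewrite !dilationE scalerA mulfV// scale1r.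
have VK y : dilation L^-1 (dilation L y) = y.
  by rewrite !dilationE scalerA mulVf// scale1r.
have -> : f = (f \o dilation L) \o dilation L^-1.
  by apply/funext => y /=; rewrite LK.
have L'0 : 0 < L^-1 by rewrite invr_gt0.
have df' : derivable (f \o dilation L) (dilation L^-1 (dilation L z)) v.
  by rewrite VK.
by case: (is_derive_dilation L'0 df').
Qed.

(** Where [f] has a derivative in the direction [v], this is the chain rule.
    Elsewhere the pullback has none either, and both sides are the conventional
    value [0] of a limit that does not exist; this spares differentiating the
    products of field components inside the residual. *)
Lemma derive_dilation (R : realType) (L : R) (f : spacetime R -> R)
    (z v : spacetime R) : 0 < L ->
  'D_v (f \o dilation L) z = L * 'D_v f (dilation L z).
Proof.
move=> L0; have [df|ndf] := pselect (derivable f (dilation L z) v).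
  by case: (is_derive_dilation L0 df).
have ndg : ~ derivable (f \o dilation L) z v by move/(derivable_dilation _ _ _ f z v L0).
by rewrite /derive (dvgP ndf) (dvgP ndg) mulr0.
Qed.

Lemma momentum_Phi (R : realType) (L : R) (i : 'I_3)
    (u : spacetime R -> fieldV R) (z : spacetime R) : 0 < L ->
  momentum i (Phi L u) z = L * momentum i u (dilation L z).
Proof.
move=> L0; rewrite /momentum /partial_t /partial_x !mulrDr !mulr_sumr.
congr (_ + _ + _); first exact: (derive_dilation _ _ (fun y => rho (u y) * vel (u y) i)).
  apply: eq_bigr => j _.
  exact: (derive_dilation _ _ (fun y => rho (u y) * vel (u y) i * vel (u y) j
    + pressure (u y) * (i == j)%:R - tau (u y) i j)).
apply: eq_bigr => j _.
exact: (derive_dilation _ _ (fun y => tau_sgs (u y) i j)).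
Qed.

Theorem proposition4p3 (R : realType) (I : set R) (Omega : set 'rV[R]_3)
    (I_open : open I) (I_interval : is_interval I) (Omega_open : open Omega)
    (M_dilation : forall L : R, 0 < L ->
       dilation L @` (I `*` Omega) = I `*` Omega)
    (L : R) (L_gt0 : 0 < L)
    (u : spacetime R -> fieldV R) (u_smooth : field_space (I `*` Omega) u)
    (i : 'I_3) :
  (forall (t : R) (x : 'rV[R]_3), (I `*` Omega) (t, x) ->
     momentum i (Phi L u) (t, x) = L * momentum i u (L * t, L *: x)) /\
  ((forall z, (I `*` Omega) z -> momentum i (Phi L u) z = 0) <->
   (forall z, (I `*` Omega) z -> momentum i u z = 0)).
Proof.
split=> [t x _|]; first exact: momentum_Phi.
have LM := M_dilation L L_gt0.
split=> u0 z Mz.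
  move: Mz; rewrite -LM => -[y My <-].
  have := u0 y My; rewrite momentum_Phi// => /eqP.
  by rewrite mulf_eq0 gt_eqF//= => /eqP.
by rewrite momentum_Phi// u0 ?mulr0// -LM; exists z.
Qed.
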